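(* Let $E$ be any graph and let $A\subseteq E^0$ be a strongly connected component of $E$. Then the semigroup $J_A^0=J_A\cup\{0\}$ is isomorphic to a subsemigroup of the Brandt $Q_A^0$-extension $\mathcal{B}^0_{Q_A}(G(E_A))$ of the graph inverse semigroup $G(E_A)$ over the induced subgraph $E_A$.
   Context: Graphs and paths. A graph means a directed graph $E=(E^0,E^1,r,s)$: disjoint sets $E^0$ (vertices) and $E^1$ (edges) with functions $s,r:E^1\to E^0$ (source and range); no finiteness is assumed. A path of non-zero length is a finite sequence of edges $x=e_1\ldots e_n$ ($n\ge 1$) with $r(e_i)=s(e_{i+1})$ for $i<n$; put $s(x)=s(e_1)$, $r(x)=r(e_n)$, $|x|=n$. Each vertex $e$ is a path of length $0$ with $s(e)=r(e)=e$. $\operatorname{Path}(E)$ is the set of all paths. If $r(a)=s(b)$, then $ab$ is the concatenation (vertices act as identities). A path $x$ is a prefix of $y$ if $y=xz$ for some path $z$. Vertices $a,b$ are strongly connected if there are paths $u,v$ with $a=s(u)=r(v)$ and $b=s(v)=r(u)$; this is an equivalence relation on $E^0$ and its classes are the strongly connected components of $E$. For non-empty $X\subseteq E^0$ the induced subgraph $E_X$ has vertex set $X$, edge set $\{x\in E^1\mid s(x)\in X,\ r(x)\in X\}$, and restricted source and range functions. Graph inverse semigroup. $G(E)$ is the semigroup with zero $0$ generated by $E^0$, $E^1$ and $E^{-1}=\{e^{-1}\mid e\in E^1\}$ (disjoint from $E^0\cup E^1$) subject to, for $a,b\in E^0$, $e,f\in E^1$: (1) $a\cdot b=a$ if $a=b$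 and $a\cdot b=0$ if $a\ne b$; (2) $s(e)\cdot e=e\cdot r(e)=e$; (3) $e^{-1}\cdot s(e)=r(e)\cdot e^{-1}=e^{-1}$; (4) $e^{-1}\cdot f=r(e)$ if $e=f$ and $e^{-1}\cdot f=0$ if $e\neq f$. Each non-zero element is uniquely of the form $uv^{-1}$ with $u,v\in\operatorname{Path}(E)$, $r(u)=r(v)$, and $u_1v_1^{-1}\cdot u_2v_2^{-1}$ equals $u_1wv_2^{-1}$ if $u_2=v_1w$ for a path $w$, equals $u_1(v_2w)^{-1}$ if $v_1=u_2w$ for a path $w$, and equals $0$ otherwise. $\mathcal{J}$-classes. Green's relation $\mathcal{J}$ on a semigroup: $a\mathcal{J}b$ iff $a$ and $b$ generate the same principal two-sided ideal. Non-zero $\mathcal{J}$-classes of $G(E)$ correspond bijectively to strongly connected components of $E$: $J_A$ denotes the $\mathcal{J}$-class containing the strongly connected component $A\subseteq E^0$, i.e. $J_A=\{uv^{-1}\mid u,v\in\operatorname{Path}(E),\ r(u)=r(v)\in A\}$. The set $J_A^0=J_A\cup\{0\}$ is a subsemigroup of $G(E)$. $I_A=\{u\in\operatorname{Path}(E)\mid r(u)\in A\}$, and $Q_A$ is the set of $u\in I_A$ such that $r(v)\notin A$ for every prefix $v$ of $u$ with $v\neq u$ (the length-zero prefix $v=s(u)$ is included when $|u|>0$). Brandt extension. For a semigroup $S$ with zero $0_S$ and a non-empty set $X$, $\mathcal{B}_X(S)=X\times S\times X\sqcup\{0\}$ with $(a,s,b)\cdot(c,t,d)=(a,st,d)$ if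 $b=c$ and $0$ if $b\ne c$, and all products involving $0$ equal to $0$. The Brandt $X^0$-extension $\mathcal{B}_X^0(S)$ is the Rees factor semigroup of $\mathcal{B}_X(S)$ by the ideal $\{(a,0_S,b)\mid a,b\in X\}\cup\{0\}$. *)

(* Defs.v *)
From HB Require Import structures.
From mathcomp Require Import all_boot monoid generic_quotient.
From mathcomp Require Import boolp classical_sets functions.

Set Implicit Arguments.
Unset Strict Implicit.
Unset Printing Implicit Defensive.

Local Open Scope quotient_scope.
Local Open Scope classical_set_scope.
Local Open Scope group_scope.

HB.mixin Record Semigroup_hasZero S of Semigroup S := {
  zero : S;
  mul0s : forall x : S, zero * x = zero;
  muls0 : forall x : S, x * zero = zero
}.

#[short(type="semigroup0Type")]
HB.structure Definition Semigroup0 := {S of Semigroup_hasZero S & Semigroup S}.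

Record congruence (T : magmaType) := Congruence {
  crel :> T -> T -> Prop;
  crel_refl : forall x, crel x x;
  crel_sym : forall x y, crel x y -> crel y x;
  crel_trans : forall x y z, crel x y -> crel y z -> crel x z;
  crel_mul : forall x x' y y', crel x x' -> crel y y' -> crel (x * y) (x' * y')
}.

Section CongruenceQuotient.
Variables (T : ChoiceMagma.type) (c : congruence T).

Definition crelb (x y : T) : bool := `[< c x y >].

Lemma crelb_refl : reflexive crelb.
Proof. by move=> x; apply/asboolP; exact: crel_refl. Qed.

Lemma crelb_sym : symmetric crelb.
Proof. by move=> x y; apply/asboolP/asboolP; exact: crel_sym. Qed.

Lemma crelb_trans : transitive crelb.
Proof.
by move=> y x z /asboolP xy /asboolP yz; apply/asboolP; exact: crel_trans yz.
Qed.

Canonical crelb_equiv := EquivRel crelb crelb_refl crelb_sym crelb_trans.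

Definition cquot := {eq_quot crelb_equiv}.
HB.instance Definition _ := Choice.on cquot.
HB.instance Definition _ := EqQuotient.on cquot.

Definition cquot_mul (x y : cquot) : cquot := \pi_cquot (repr x * repr y).

HB.instance Definition _ := hasMul.Build cquot cquot_mul.

Lemma cquot_eqP (x y : T) : \pi_cquot x = \pi_cquot y <-> c x y.
Proof. by split=> [/eqmodP/asboolP|cxy]; last exact/eqmodP/asboolP. Qed.

Lemma cquot_mulE (x y : T) : \pi_cquot x * \pi_cquot y = \pi_cquot (x * y).
Proof. by apply/cquot_eqP; apply: crel_mul; apply/cquot_eqP; rewrite reprK. Qed.

Lemma cquot_surj (x : cquot) : exists t : T, x = \pi_cquot t.
Proof. by exists (repr x); rewrite reprK. Qed.

Lemma cquot_mulA :
  (forall x y z, c (x * (y * z)) (x * y * z)) -> associative (@mul cquot).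
Proof.
move=> cA x y z; case: (cquot_surj x) (cquot_surj y) (cquot_surj z).
move=> {}x -> [{}y ->] [{}z ->].
rewrite (cquot_mulE y z) (cquot_mulE x) (cquot_mulE x y) (cquot_mulE (x * y)).
by apply/cquot_eqP; exact: cA.
Qed.

End CongruenceQuotient.

Definition two_sided_ideal (S : semigroupType) (I : set S) : Prop :=
  forall s x, I x -> I (s * x) /\ I (x * s).

Definition principal_ideal (S : semigroupType) (x : S) : set S :=
  smallest (@two_sided_ideal S) [set x].

Definition greenJ (S : semigroupType) (x y : S) : Prop :=
  principal_ideal x = principal_ideal y.

Definition isomorphic_subsemigroups (S T : semigroupType)
    (P : set S) (Q : set T) : Prop :=
  [/\ mulg_closed (mem P), mulg_closed (mem Q) &
      exists f : S -> T,
        set_bij P Q f /\ {in P &, {morph f : x y / x * y}}].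

Section ReesFactor.
Variables (S : semigroupType) (I : set S) (idealI : two_sided_ideal I).

Definition rees_rel (x y : S) : Prop := x = y \/ I x /\ I y.

Fact rees_rel_sym x y : rees_rel x y -> rees_rel y x.
Proof. by case=> [->|[? ?]]; [left|right]. Qed.

Fact rees_rel_trans x y z : rees_rel x y -> rees_rel y z -> rees_rel x z.
Proof. by case=> [->//|[Ix Iy]] [<-|[_ Iz]]; right. Qed.

Fact rees_rel_mul x x' y y' :
  rees_rel x x' -> rees_rel y y' -> rees_rel (x * y) (x' * y').
Proof.
case=> [<-|[Ix Ix']]; last first.
  by move=> _; right; split; [case: (idealI y Ix)|case: (idealI y' Ix')].
case=> [<-|[Iy Iy']]; first by left.
by right; split; [case: (idealI x Iy)|case: (idealI x Iy')].
Qed.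

Definition rees_congruence : congruence S :=
  Congruence (fun x => or_introl (erefl x))
    rees_rel_sym rees_rel_trans rees_rel_mul.

Definition rees := cquot rees_congruence.
HB.instance Definition _ := Magma.on rees.
HB.instance Definition _ := Choice.on rees.

Fact rees_mulA : associative (@mul rees).
Proof. by apply: cquot_mulA => x y z; left; rewrite mulgA. Qed.

HB.instance Definition _ := Magma_isSemigroup.Build rees rees_mulA.

End ReesFactor.

Inductive brandt (X S : Type) : Type :=
| BZero
| BTriple of X & S & X.
Arguments BZero {X S}.

Section Brandt.
Variables (X : Type) (S : semigroupType).
Local Notation B := (brandt X S).

HB.instance Definition _ := gen_eqMixin B.
HB.instance Definition _ := gen_choiceMixin B.

Definition brandt_mul (x y : B) : B :=
  match x, y with
  | BTriple a s b, BTriple c t d =>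
      if `[< b = c >] then BTriple a (s * t) d else BZero
  | _, _ => BZero
  end.

Fact brandt_mulA : associative brandt_mul.
Proof.
case=> [|a s b] [|c t d] [|e u f] //=; first by case: ifP.
case: (asboolP (b = c)) => bc; case: (asboolP (d = e)) => de //=.
- by rewrite !asboolT// mulgA.
- by rewrite asboolF.
- by rewrite asboolF.
Qed.

HB.instance Definition _ := isSemigroup.Build B brandt_mulA.

End Brandt.

Section BrandtZeroExtension.
Variables (X : Type) (S : semigroup0Type).

Definition brandt_ideal : set (brandt X S) :=
  [set x | x = BZero \/ exists a b, x = BTriple a zero b].

Fact brandt_idealP : two_sided_ideal brandt_ideal.
Proof.
move=> [|c s d] x [->|[a [b ->]]]; split; try by left.
- rewrite /mul /=; case: asboolP => _; last by left.
  by right; exists c, b; rewrite muls0.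
- rewrite /mul /=; case: asboolP => _; last by left.
  by right; exists a, d; rewrite mul0s.
Qed.

Definition brandt0 := rees brandt_idealP.
HB.instance Definition _ := Semigroup.on brandt0.

End BrandtZeroExtension.

Record digraph := Digraph {
  vertex : Type;
  edge : Type;
  esrc : edge -> vertex;
  etgt : edge -> vertex
}.

Section Paths.
Variable E : digraph.

Fixpoint chain (a : vertex E) (p : seq (edge E)) : Prop :=
  if p is e :: p' then esrc e = a /\ chain (etgt e) p' else True.

(* The start vertex is determined by the edges unless there are none, in which
   case it is the length-zero path at that vertex. *)
Record gpath := GPath {
  psrc : vertex E;
  pedges : seq (edge E);
  pchain : chain psrc pedges
}.

Definition chain_end (a : vertex E) (p : seq (edge E)) : vertex E :=
  last a (map (@etgt E) p).

Definition ptgt (u : gpath) : vertex E := chain_end (psrc u) (pedges u).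

Fact chain_cat a p q :
  chain a p -> chain (chain_end a p) q -> chain a (p ++ q).
Proof.
elim: p a => [//|e p IHp] a /= [ea pe] qe.
by split=> //; apply: IHp.
Qed.

Definition pcat (u v : gpath) (uv : ptgt u = psrc v) : gpath :=
  GPath (chain_cat (pchain u)
    (eq_ind_r (fun a => chain a (pedges v)) (pchain v) uv)).

Definition prefix_path (v u : gpath) : Prop :=
  exists (z : gpath) (vz : ptgt v = psrc z), u = pcat vz.

Definition strongly_connected (a b : vertex E) : Prop :=
  exists u v : gpath, [/\ a = psrc u, a = ptgt v, b = psrc v & b = ptgt u].

Definition strongly_connected_component (A : set (vertex E)) : Prop :=
  exists a, A = [set b | strongly_connected a b].

Definition paths_into (A : set (vertex E)) : set gpath := [set u | A (ptgt u)].

Definition first_paths_into (A : set (vertex E)) : set gpath :=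
  [set u | paths_into A u /\
           forall v, prefix_path v u -> v <> u -> ~ A (ptgt v)].

End Paths.

Definition induced_subgraph (E : digraph) (X : set (vertex E)) : digraph :=
  @Digraph {a : vertex E | X a} {e : edge E | X (esrc e) /\ X (etgt e)}
    (fun e => exist X (esrc (sval e)) (proj1 (svalP e)))
    (fun e => exist X (etgt (sval e)) (proj2 (svalP e))).

Section GraphInverseSemigroup.
Variable E : digraph.

Inductive gis_term : Type :=
| TZero
| TVertex of vertex E
| TEdge of edge E
| TInv of edge E
| TMul of gis_term & gis_term.

HB.instance Definition _ := gen_eqMixin gis_term.
HB.instance Definition _ := gen_choiceMixin gis_term.
HB.instance Definition _ := hasMul.Build gis_term TMul.

(* The least congruence making the terms a semigroup with zero in which the
   defining relations hold. *)
Inductive gis_rel : gis_term -> gis_term -> Prop :=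
| gis_refl x : gis_rel x x
| gis_sym x y : gis_rel x y -> gis_rel y x
| gis_trans x y z : gis_rel x y -> gis_rel y z -> gis_rel x z
| gis_mul x x' y y' :
    gis_rel x x' -> gis_rel y y' -> gis_rel (x * y) (x' * y')
| gis_mulA x y z : gis_rel (x * (y * z)) (x * y * z)
| gis_mul0l x : gis_rel (TZero * x) TZero
| gis_mul0r x : gis_rel (x * TZero) TZero
| gis_vertex_eq a : gis_rel (TVertex a * TVertex a) (TVertex a)
| gis_vertex_neq a b : a <> b -> gis_rel (TVertex a * TVertex b) TZero
| gis_src_edge e : gis_rel (TVertex (esrc e) * TEdge e) (TEdge e)
| gis_edge_tgt e : gis_rel (TEdge e * TVertex (etgt e)) (TEdge e)
| gis_inv_src e : gis_rel (TInv e * TVertex (esrc e)) (TInv e)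
| gis_tgt_inv e : gis_rel (TVertex (etgt e) * TInv e) (TInv e)
| gis_inv_eq e : gis_rel (TInv e * TEdge e) (TVertex (etgt e))
| gis_inv_neq e f : e <> f -> gis_rel (TInv e * TEdge f) TZero.

Definition gis_congruence : congruence gis_term :=
  Congruence gis_refl gis_sym gis_trans gis_mul.

Definition gis := cquot gis_congruence.
HB.instance Definition _ := Magma.on gis.
HB.instance Definition _ := Choice.on gis.

Definition gis_of (t : gis_term) : gis := \pi_(cquot gis_congruence) t.

Fact gis_mulA_subproof : associative (@mul gis).
Proof. by apply: cquot_mulA; exact: gis_mulA. Qed.

HB.instance Definition _ := Magma_isSemigroup.Build gis gis_mulA_subproof.

Fact gis_mul0s_subproof (x : gis) : gis_of TZero * x = gis_of TZero.
Proof.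
case: (cquot_surj x) => {}x ->.
by rewrite [LHS]cquot_mulE; apply/cquot_eqP; exact: gis_mul0l.
Qed.

Fact gis_muls0_subproof (x : gis) : x * gis_of TZero = gis_of TZero.
Proof.
case: (cquot_surj x) => {}x ->.
by rewrite [LHS]cquot_mulE; apply/cquot_eqP; exact: gis_mul0r.
Qed.

HB.instance Definition _ :=
  Semigroup_hasZero.Build gis gis_mul0s_subproof gis_muls0_subproof.

(* For A strongly connected the vertices of A are J-equivalent, so this is a
   single J-class, consisting of the u v^-1 with ptgt u = ptgt v in A. *)
Definition component_Jclass (A : set (vertex E)) : set gis :=
  [set x | exists2 a, A a & greenJ x (gis_of (TVertex a))].

Definition component_Jclass0 (A : set (vertex E)) : set gis :=
  component_Jclass A `|` [set zero].

End GraphInverseSemigroup.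

(* Main.v *)
Require Import Defs.
From mathcomp Require Import all_boot monoid generic_quotient.
From mathcomp Require Import boolp classical_sets functions.

Set Implicit Arguments.
Unset Strict Implicit.
Unset Printing Implicit Defensive.

Local Open Scope quotient_scope.
Local Open Scope classical_set_scope.
Local Open Scope group_scope.

Import Defs.

(** Write B for the set of (a, s, b) in the Brandt semigroup over Q_A with
    s = r(a) s r(b), together with 0. Such a triple is sent to a s b^-1 in G(E),
    where s is read in G(E) through the inclusion of E_A in E. This map, spread,
    is multiplicative on B: in the product of a s b^-1 and c t d^-1 the middle
    factor b^-1 c is r(b) when b = c, and it is 0 when b and c are distinct,
    since two distinct elements of Q_A are never prefixes of one another
    (gpi_gp_prefix, first_paths_prefix).

    The image of spread is J_A^0 (spread_image). In one direction, a s b^-1 and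
    s = a^-1 (a s b^-1) b generate the same ideal, and s is either 0 or
    J-equivalent to a vertex of A. In the other direction, an element of J_A has
    the form u v^-1 with r(u) = r(v) in A; u and v are cut at their first visits
    to A, and what follows the cuts stays inside A because A is convex for
    reachability (first_visit, chain_lift).

    Two elements of B have the same image exactly when they are identified in the
    Brandt 0-extension (spread_ker): s is recovered as a^-1 (a s b^-1) b, and if
    the image is not 0 the paths a and b are recovered by orthogonality. Hence
    J_A^0 and the image of B in the 0-extension are images of the same semigroup
    under homomorphisms with the same kernel (isomorphic_images).

    All this rests on facts about the presented semigroup G(E) for which certain
    elements must be told apart, namely that G(E_A) embeds in G(E) and that r(u) is determined up
    to strong connectedness by the J-class of u v^-1. They come from the action of
    G(E) on paths by partial maps: a vertex acts as the identity on the paths that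
    start there, an edge prepends itself, and its inverse removes it. The element
    u v^-1 sends v to u and is defined only on extensions of v, so by the
    existence of normal forms (normal_formP) the action is faithful
    (gact_inj). *)

(** * Paths and reachability *)

Section Reachability.
Variable E : digraph.
Implicit Types (a b c : vertex E) (p q : seq (edge E)).

Definition reach a b := exists2 p, chain a p & chain_end a p = b.

Lemma chain_end_cat a p q :
  chain_end a (p ++ q) = chain_end (chain_end a p) q.
Proof. by rewrite /chain_end map_cat last_cat. Qed.

Lemma chain_catP a p q :
  chain a (p ++ q) <-> chain a p /\ chain (chain_end a p) q.
Proof.
split=> [|[]]; last exact: chain_cat.
elim: p a => [//|e p IHp] a /= [-> /IHp[? ?]].
by split.
Qed.

Lemma reach_refl a : reach a a.
Proof. by exists [::]. Qed.

Lemma reach_trans a b c : reach a b -> reach b c -> reach a c.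
Proof.
move=> [p ap <-] [q bq <-]; exists (p ++ q); last exact: chain_end_cat.
exact: chain_cat.
Qed.

Lemma strongly_connectedP a b :
  strongly_connected a b <-> reach a b /\ reach b a.
Proof.
split=> [[u [v [au av bv bu]]]|].
  split; [exists (pedges u)|exists (pedges v)].
  - by rewrite au; exact: pchain.
  - by rewrite bu au.
  - by rewrite bv; exact: pchain.
  - by rewrite av bv.
move=> [[p ap pb] [q bq qa]].
by exists (GPath ap), (GPath bq); split.
Qed.

(** The one consequence of strong connectedness that matters below: paths
    between vertices of A do not leave A. *)
Lemma component_convex (A : set (vertex E)) a b c :
  strongly_connected_component A ->
  A a -> A c -> reach a b -> reach b c -> A b.
Proof.
move=> [o ->] /strongly_connectedP[oa _] /strongly_connectedP[_ co] ab bc.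
by apply/strongly_connectedP; split; [exact: reach_trans ab|exact: reach_trans co].
Qed.

Lemma gpath_eq (u v : gpath E) :
  psrc u = psrc v -> pedges u = pedges v -> u = v.
Proof.
case: u v => [a p ap] [b q bq] /= ab pq; subst b q.
by rewrite (Prop_irrelevance ap bq).
Qed.

Lemma prefix_pathP (v u : gpath E) :
  prefix_path v u <->
  psrc v = psrc u /\ exists q, pedges u = pedges v ++ q.
Proof.
split=> [[z [vz ->]]|[vu [q uq]]]; first by split=> //; exists (pedges z).
have := pchain u; rewrite uq -vu => /chain_catP[_ vq].
by exists (GPath vq), erefl; apply: gpath_eq.
Qed.

(** A path ending in A factors through Q_A: cut it at its first visit to A. *)
Lemma first_visit (A : set (vertex E)) a p :
  chain a p -> A (chain_end a p) ->
  exists2 u : gpath E, first_paths_into A u &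
    exists q, [/\ psrc u = a, p = pedges u ++ q & chain (ptgt u) q].
Proof.
move=> ap Ap.
have [p1 [p2 [pE Ap1 p1_min]]] : exists p1 p2,
    [/\ p = p1 ++ p2, A (chain_end a p1) &
        forall q r, p1 = q ++ r -> r <> [::] -> ~ A (chain_end a q)].
  (* Stop at once if the path starts in A, otherwise step along its first edge. *)
  elim: p a {ap} Ap => [|e p IHp] a Ap.
    by exists [::], [::]; split=> // -[|? ?] // [].
  have [Aa|nAa] := pselect (A a).
    by exists [::], (e :: p); split=> // -[|? ?] // [].
  have [p1 [p2 [-> Ap1 p1_min]]] := IHp _ Ap.
  exists (e :: p1), p2; split=> // -[|f q] r //= [<- p1E] r0.
  exact: (p1_min _ _ p1E r0).
move: ap; rewrite pE => /chain_catP[ap1 p1p2].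
exists (GPath ap1); last by exists p2.
split=> // v /prefix_pathP[/= va [q p1E]] v_neq.
rewrite /ptgt va; apply: (p1_min _ _ p1E) => q0; apply: v_neq.
by apply: gpath_eq => //=; rewrite p1E q0 cats0.
Qed.

Lemma first_paths_prefix (A : set (vertex E)) (u v : gpath E) :
  first_paths_into A u -> first_paths_into A v -> prefix_path u v -> u = v.
Proof.
by move=> [Au _] [_ v_min] uv; apply: contrapT => /(v_min _ uv).
Qed.

End Reachability.

(** * The action of the graph inverse semigroup on paths *)

Section Action.
Variable E : digraph.
Implicit Types (a b c : vertex E) (e f : edge E) (p q : seq (edge E)).
Implicit Types (s t : gis_term E) (x y : gis E).

(** The points acted on are a start vertex with a list of edges. The list is not
    required to be a chain: the defining relations hold for the action anyway,
    and no proof has to be carried along. *)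
Definition state := (vertex E * seq (edge E))%type.
Implicit Type z : state.

Fixpoint tact t z : option state :=
  match t with
  | TZero => None
  | TVertex a => if `[< z.1 = a >] then Some z else None
  | TEdge e => if `[< z.1 = etgt e >] then Some (esrc e, e :: z.2) else None
  | TInv e =>
      if z.2 is f :: p then
        if `[< z.1 = esrc e /\ e = f >] then Some (etgt e, p) else None
      else None
  | TMul s t => obind (tact s) (tact t z)
  end.

Lemma tact_rel s t : gis_rel s t -> tact s =1 tact t.
Proof.
elim=> {s t}.
- by move=> s z.
- by move=> s t _ IH z; rewrite IH.
- by move=> s t u _ IH1 _ IH2 z; rewrite IH1.
- by move=> s s' t t' _ IHs _ IHt z /=; rewrite IHt; case: tact => /=.
- by move=> s t u z /=; case: (tact u z).
- by move=> s z /=; case: tact.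
- by [].
- by move=> a z /=; case: asboolP => //= ?; rewrite asboolT.
- by move=> a b ab z /=; case: asboolP => //= ->; rewrite asboolF // => /esym.
- by move=> e z /=; case: asboolP => //= ?; rewrite asboolT.
- by move=> e z /=; case: asboolP => //= ->; rewrite asboolT.
- move=> e [a p] /=; case: asboolP => //= a_neq.
  by case: p => // f p; rewrite asboolF // => -[].
- move=> e [a [|f p]] //=; case: asboolP => //= _.
  by rewrite asboolT.
- move=> e [a p] /=; case: asboolP => //= ->.
  by rewrite asboolT.
- move=> e f ef [a p] /=; case: asboolP => //= .
  by rewrite asboolF // => -[].
Qed.

Definition gact x : state -> option state := tact (repr x).

Lemma gact_of t : gact (gis_of t) =1 tact t.
Proof. by apply: tact_rel; apply/(cquot_eqP (gis_congruence E)); rewrite reprK. Qed.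

Lemma gis_of_surj x : exists t, x = gis_of t.
Proof. exact: cquot_surj. Qed.

Lemma gis_ofM s t : gis_of (TMul s t) = gis_of s * gis_of t.
Proof. by rewrite [RHS]cquot_mulE. Qed.

Lemma gis_of_eq s t : gis_rel s t -> gis_of s = gis_of t.
Proof. by move=> st; apply/(cquot_eqP (gis_congruence E)). Qed.

Lemma gactM x y z : gact (x * y) z = obind (gact x) (gact y z).
Proof.
have [[s ->] [t ->]] := (gis_of_surj x, gis_of_surj y).
rewrite -gis_ofM !gact_of /=; case: tact => //= ?.
by rewrite gact_of.
Qed.

Lemma gact0 z : gact zero z = None.
Proof. exact: gact_of. Qed.

(** The generators only lengthen or shorten a path at its start, so the action
    preserves the end of a path. This is the invariant behind the description of
    the J-classes. *)
Lemma gact_path x z z' : gact x z = Some z' -> chain z.1 z.2 ->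
  chain z'.1 z'.2 /\ chain_end z'.1 z'.2 = chain_end z.1 z.2.
Proof.
have [t ->] := gis_of_surj x; rewrite gact_of.
elim: t z z' => [|a|e|e|s IHs t IHt] z z' //=.
- by case: asboolP => // _ [<-].
- by case: asboolP => // zE [<-] /=; rewrite zE.
- by case: z => a [|f p] //=; case: asboolP => // -[_ <-] [<-] /= [].
- case Et: tact => [w|] //= /IHs ws zz.
  by have [ww <-] := IHt _ _ Et zz; apply: ws.
Qed.

(** * Normal forms *)

Definition gv a : gis E := gis_of (TVertex a).
Definition ge e : gis E := gis_of (TEdge e).
Definition gi e : gis E := gis_of (TInv e).

Lemma gvv a : gv a * gv a = gv a.
Proof. by rewrite -gis_ofM; apply/gis_of_eq/gis_vertex_eq. Qed.
Lemma gv_neq a b : a <> b -> gv a * gv b = zero.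
Proof. by move=> ab; rewrite -gis_ofM; apply/gis_of_eq/gis_vertex_neq. Qed.
Lemma gv_ge e : gv (esrc e) * ge e = ge e.
Proof. by rewrite -gis_ofM; apply/gis_of_eq/gis_src_edge. Qed.
Lemma ge_gv e : ge e * gv (etgt e) = ge e.
Proof. by rewrite -gis_ofM; apply/gis_of_eq/gis_edge_tgt. Qed.
Lemma gi_gv e : gi e * gv (esrc e) = gi e.
Proof. by rewrite -gis_ofM; apply/gis_of_eq/gis_inv_src. Qed.
Lemma gv_gi e : gv (etgt e) * gi e = gi e.
Proof. by rewrite -gis_ofM; apply/gis_of_eq/gis_tgt_inv. Qed.
Lemma gi_ge e : gi e * ge e = gv (etgt e).
Proof. by rewrite -gis_ofM; apply/gis_of_eq/gis_inv_eq. Qed.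
Lemma gi_ge_neq e f : e <> f -> gi e * ge f = zero.
Proof. by move=> ef; rewrite -gis_ofM; apply/gis_of_eq/gis_inv_neq. Qed.

(** The path p from a, and its inverse, as elements of the semigroup. The vertex
    a matters only when p is empty; the trailing vertex makes the product
    meaningful in that case and is absorbed in all others. *)
Fixpoint gp a p : gis E := if p is e :: p' then ge e * gp (etgt e) p' else gv a.
Fixpoint gpi a p : gis E := if p is e :: p' then gpi (etgt e) p' * gi e else gv a.

Lemma gv_gp a p : chain a p -> gv a * gp a p = gp a p.
Proof. by case: p => [|e p] /=; [rewrite gvv|move=> [<- _]; rewrite mulgA gv_ge]. Qed.

Lemma gpi_gv a p : chain a p -> gpi a p * gv a = gpi a p.
Proof. by case: p => [|e p] /=; [rewrite gvv|move=> [<- _]; rewrite -mulgA gi_gv]. Qed.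

Lemma gp_gv a p : gp a p * gv (chain_end a p) = gp a p.
Proof. by elim: p a => [|e p IHp] a /=; [exact: gvv|rewrite -mulgA IHp]. Qed.

Lemma gv_gpi a p : gv (chain_end a p) * gpi a p = gpi a p.
Proof. by elim: p a => [|e p IHp] a /=; [exact: gvv|rewrite mulgA IHp]. Qed.

Lemma gpi_gp a p : chain a p -> gpi a p * gp a p = gv (chain_end a p).
Proof.
elim: p a => [|e p IHp] a /=; first by rewrite gvv.
move=> [_ ep]; rewrite -mulgA (mulgA (gi e)) gi_ge gv_gp //; exact: IHp.
Qed.

Lemma gp_cat a p q :
  chain (chain_end a p) q -> gp a (p ++ q) = gp a p * gp (chain_end a p) q.
Proof.
elim: p a => [|e p IHp] a /= pq; first by rewrite gv_gp.
by rewrite IHp // mulgA.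
Qed.

Lemma gpi_cat a p q :
  chain (chain_end a p) q -> gpi a (p ++ q) = gpi (chain_end a p) q * gpi a p.
Proof.
elim: p a => [|e p IHp] a /= pq; first by rewrite gpi_gv.
by rewrite IHp // mulgA.
Qed.

(** The inverse of the first path cancels the common edges of the two; at the
    first difference the product becomes 0. *)
Lemma gpi_gp_prefix a p b q : chain a p -> chain b q ->
  gpi a p * gp b q = zero \/
  a = b /\ ((exists r, q = p ++ r) \/ (exists r, p = q ++ r)).
Proof.
elim: p a b q => [|e p IHp] a b q.
  move=> _ bq; have [<-|ab] := pselect (a = b).
    by right; split=> //; left; exists q.
  by left; rewrite /= -(gv_gp bq) mulgA gv_neq // mul0s.
case: q => [|f q] ap bq.
  have [<-|ab] := pselect (a = b).
    by right; split=> //; right; exists (e :: p).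
  by left; rewrite -(gpi_gv ap) -mulgA gv_neq // muls0.
move: ap bq => /= [<- ep] [<- fq].
rewrite -mulgA (mulgA (gi e)).
have [ef|ef] := pselect (e = f); last by left; rewrite gi_ge_neq // mul0s muls0.
subst f; rewrite gi_ge gv_gp //.
have [->|[_ [[r ->]|[r ->]]]] := IHp _ _ _ ep fq; first by left.
  by right; split=> //; left; exists r.
by right; split=> //; right; exists r.
Qed.

Inductive normal_form x : Prop :=
| NF0 of x = zero
| NF a p b q of chain a p & chain b q & chain_end a p = chain_end b q
    & x = gp a p * gpi b q.

Lemma normal_form_mulv a x : normal_form x -> normal_form (gv a * x).
Proof.
case=> [->|b p c q bp cq pq ->]; first by apply: NF0; rewrite muls0.
have [->|ab] := pselect (a = b); first by rewrite mulgA gv_gp //; exact: NF pq _.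
by apply: NF0; rewrite -(gv_gp bp) !mulgA gv_neq // !mul0s.
Qed.

Lemma normal_form_mule e x : normal_form x -> normal_form (ge e * x).
Proof.
case=> [->|b p c q bp cq pq ->]; first by apply: NF0; rewrite muls0.
have [eb|ab] := pselect (etgt e = b).
  by subst b; apply: (@NF _ (esrc e) (e :: p) c q) => //=; rewrite mulgA.
apply: NF0; rewrite -ge_gv -(gv_gp bp) -!mulgA (mulgA (gv (etgt e))).
by rewrite gv_neq // mul0s muls0.
Qed.

Lemma normal_form_muli e x : normal_form x -> normal_form (gi e * x).
Proof.
case=> [->|b [|f p] c q bp cq pq ->]; first by apply: NF0; rewrite muls0.
  (* The first path is empty, so e^-1 joins the inverse of the second one. *)
  have [eb|eb] := pselect (esrc e = b); last first.
    apply: NF0; rewrite /= -gi_gv -!mulgA (mulgA (gv (esrc e))).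
    by rewrite gv_neq // mul0s muls0.
  have qe : chain (chain_end c q) [:: e] by rewrite -pq.
  apply: (@NF _ (etgt e) [::] c (q ++ [:: e])) => //=.
  - exact: chain_cat.
  - by rewrite chain_end_cat.
  - by rewrite gpi_cat //= -eb !mulgA gi_gv gvv gv_gi.
move: bp => /= [_ fp].
have [ef|ef] := pselect (e = f); last first.
  by apply: NF0; rewrite !mulgA gi_ge_neq // !mul0s.
by subst f; apply: (@NF _ (etgt e) p c q); rewrite // !mulgA gi_ge gv_gp.
Qed.

(** Normal forms are closed under left multiplication by the generators. As
    terms are arbitrary trees of products, the induction has to carry closure
    under left multiplication by the whole term; membership is stated beside it
    because there is no unit to multiply by. *)
Lemma normal_formP x : normal_form x.
Proof.
have [t ->] := gis_of_surj x.
suff [] : normal_form (gis_of t) /\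
    forall y, normal_form y -> normal_form (gis_of t * y) by [].
elim: t => [|a|e|e|s [_ IHs] t [tN IHt]].
- by split=> [|y _]; apply: NF0; rewrite ?mul0s.
- split; last exact: normal_form_mulv.
  by apply: (@NF _ a [::] a [::]); rewrite //= gvv.
- split; last exact: normal_form_mule.
  by apply: (@NF _ (esrc e) [:: e] (etgt e) [::]); rewrite //= !ge_gv.
- split; last exact: normal_form_muli.
  by apply: (@NF _ (etgt e) [::] (esrc e) [:: e]); rewrite //= !gv_gi.
- rewrite gis_ofM; split; first exact: IHs.
  by move=> y yN; rewrite -mulgA; apply/IHs/IHt.
Qed.

Lemma gact_gp a p q : chain a p -> gact (gp a p) (chain_end a p, q) = Some (a, p ++ q).
Proof.
elim: p a => [|e p IHp] a /=; first by rewrite gact_of /= asboolT.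
move=> [<- ep]; rewrite gactM IHp //= gact_of /= asboolT //.
Qed.

Lemma gact_gpi a p q : chain a p -> gact (gpi a p) (a, p ++ q) = Some (chain_end a p, q).
Proof.
elim: p a => [|e p IHp] a /=; first by rewrite gact_of /= asboolT.
by move=> [<- ep]; rewrite gactM gact_of /= asboolT //= IHp.
Qed.

Lemma gact_gpi_dom a p z w : chain a p -> gact (gpi a p) z = Some w ->
  z = (a, p ++ w.2).
Proof.
elim: p a z => [|e p IHp] a z /=.
  by rewrite gact_of /=; case: asboolP => // <- _ [<-]; case: z.
move=> [<- ep]; rewrite gactM gact_of; case: z => c [|f q] //=.
by case: asboolP => //= -[-> <-] /IHp => /(_ ep) [->].
Qed.

(** Together with gact_nf_dom, this lets u v^-1 be read off from its action: v is
    the shortest path in its domain, and u is the image of v. *)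
Lemma gact_nf a p b q : chain a p -> chain b q -> chain_end a p = chain_end b q ->
  gact (gp a p * gpi b q) (b, q) = Some (a, p).
Proof.
move=> ap bq pq; rewrite gactM -{2}(cats0 q) gact_gpi //= -pq gact_gp //.
by rewrite cats0.
Qed.

Lemma gact_nf_dom a p b q z : chain b q ->
  gact (gp a p * gpi b q) z <> None -> exists r, z = (b, q ++ r).
Proof.
move=> bq; rewrite gactM; case Ez: gact => [w|] //= _; exists w.2.
exact: gact_gpi_dom Ez.
Qed.

(** The action is faithful, since each of two normal forms with the same action
    is defined on the second path of the other, so these two paths are prefixes of
    one another. *)
Lemma gact_inj x y : gact x =1 gact y -> x = y.
Proof.
case: (normal_formP x) => [->|a p b q ap bq pq ->];
  case: (normal_formP y) => [->|a' p' b' q' ap' bq' pq' ->] // xy.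
- by have := xy (b', q'); rewrite gact0 gact_nf.
- by have := xy (b, q); rewrite gact0 gact_nf.
have [r] : exists r, (b, q) = (b', q' ++ r).
  by apply: (@gact_nf_dom a' p') => //; rewrite -xy gact_nf.
have [r'] : exists r, (b', q') = (b, q ++ r).
  by apply: (@gact_nf_dom a p) => //; rewrite xy gact_nf.
move=> [_ q'E] [bE qE]; subst b'.
have r0 : r' ++ r = [::].
  apply/nilP; rewrite /nilp; have := congr1 size qE.
  by rewrite q'E !size_cat -addnA => /eqP; rewrite -{1}(addn0 (size q)) eqn_add2l eq_sym.
have {r0} r'0 : r' = [::] by case: r' r0 {q'E}.
rewrite r'0 cats0 in q'E; subst q'.
have := xy (b, q); rewrite !gact_nf // => -[-> ->] //.
Qed.

End Action.

(** * Principal ideals and Green's relation *)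

Section PrincipalIdeals.
Variable S : semigroupType.
Implicit Types x y l r : S.

Lemma principal_ideal_self x : principal_ideal x x.
Proof. exact: sub_gen_smallest. Qed.

Lemma principal_ideal_mul x l r : principal_ideal x (l * x * r).
Proof.
move=> I [idealI xI]; have [lxI _] := idealI l x (xI x erefl).
by case: (idealI r _ lxI).
Qed.

Lemma principal_ideal_sub (I : set S) x y :
  two_sided_ideal I -> I x -> principal_ideal x y -> I y.
Proof. by move=> idealI Ix xy; apply: xy; split=> // _ ->. Qed.

Lemma principal_ideal_ideal x : two_sided_ideal (principal_ideal x).
Proof.
move=> s y xy; split=> I [idealI xI];
  by case: (idealI s y (xy I (conj idealI xI))).
Qed.

Lemma greenJ_mul x y l r l' r' :
  y = l * x * r -> x = l' * y * r' -> greenJ x y.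
Proof.
move=> yE xE; rewrite /greenJ seteqP; split=> z.
  apply: principal_ideal_sub; first exact: principal_ideal_ideal.
  by rewrite xE; exact: principal_ideal_mul.
apply: principal_ideal_sub; first exact: principal_ideal_ideal.
by rewrite yE; exact: principal_ideal_mul.
Qed.

End PrincipalIdeals.

(** * Homomorphic images with the same kernel *)

(** The homomorphism theorem, for maps that are multiplicative on a subsemigroup
    only: an element of the first image is lifted to B and then mapped on. *)
Lemma isomorphic_images (R S T : semigroupType) (r0 : R) (B : set R)
    (p : R -> S) (q : R -> T) :
  (forall x y, B x -> B y ->
     [/\ B (x * y), p (x * y) = p x * p y & q (x * y) = q x * q y]) ->
  (forall x y, B x -> B y -> p x = p y <-> q x = q y) ->
  isomorphic_subsemigroups (p @` B) (q @` B).
Proof.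
move=> Bmul Bker; split.
- move=> _ _ /set_mem[x Bx <-] /set_mem[y By <-]; apply/mem_set.
  by have [Bxy pxy _] := Bmul x y Bx By; exists (x * y).
- move=> _ _ /set_mem[x Bx <-] /set_mem[y By <-]; apply/mem_set.
  by have [Bxy _ qxy] := Bmul x y Bx By; exists (x * y).
pose lift s := xget r0 [set x | B x /\ p x = s].
have liftP x : B x -> B (lift (p x)) /\ p (lift (p x)) = p x.
  by move=> Bx; apply: (@xgetPex _ r0 [set y | B y /\ p y = p x]); exists x.
have qlift x : B x -> q (lift (p x)) = q x.
  by move=> Bx; have [? ?] := liftP x Bx; apply/Bker.
exists (q \o lift); split; first split.
- by move=> _ [x Bx <-]; exists x => //=; rewrite qlift.
- move=> _ _ /set_mem[x Bx <-] /set_mem[y By <-] /=.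
  by rewrite !qlift // => /Bker; apply.
- by move=> _ [x Bx <-]; exists (p x); [exists x|rewrite /= qlift].
- move=> _ _ /set_mem[x Bx <-] /set_mem[y By <-] /=.
  have [Bxy pxy qxy] := Bmul x y Bx By.
  by rewrite -pxy !qlift.
Qed.

(** * The J-classes of vertices *)

Section JClasses.
Variable E : digraph.
Implicit Types (a b c : vertex E) (x y : gis E).

(** In terms of normal forms these are 0 and the u v^-1 with r(u) reachable from
    a; the description by the action makes it evident that they form an ideal on
    both sides. *)
Definition reaching a : set (gis E) :=
  [set x | forall z, chain z.1 z.2 -> gact x z <> None ->
           reach a (chain_end z.1 z.2)].

Lemma reaching_ideal a : two_sided_ideal (reaching a).
Proof.
move=> y x ax; split=> z zz; rewrite gactM.
  by case Ez: (gact x z) => [w|] //= _; apply: ax; rewrite ?Ez.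
case Ez: (gact y z) => [w|] //=.
by have [ww <-] := gact_path Ez zz; exact: ax.
Qed.

Lemma reaching_nf a b p c q : chain b p -> chain c q ->
  chain_end b p = chain_end c q ->
  reaching a (gp b p * gpi c q) <-> reach a (chain_end b p).
Proof.
move=> bp cq pq; split=> [/(_ (c, q) cq)|].
  by rewrite gact_nf //= -pq; apply.
move=> ab z zz /(gact_nf_dom cq)[r zE]; move: zz; rewrite zE /=.
move=> /chain_catP[_ qr]; rewrite chain_end_cat -pq.
by apply: reach_trans ab _; exists r => //; rewrite pq.
Qed.

(** Each of two J-equivalent elements lies in every ideal that contains the
    other; this is used for the ideal of elements reachable from a, and for that
    of elements reachable from r(u). *)
Lemma greenJ_vertex_nf a b p c q : chain b p -> chain c q ->
  chain_end b p = chain_end c q -> greenJ (gp b p * gpi c q) (gv a) ->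
  reach a (chain_end b p) /\ reach (chain_end b p) a.
Proof.
move=> bp cq pq xa; have gvE d : gv d = gp d [::] * gpi d [::] by rewrite /= gvv.
have reachingP d x y :
    principal_ideal x = principal_ideal y -> reaching d x -> reaching d y.
  move=> xy dx; apply: (principal_ideal_sub (@reaching_ideal d) dx).
  by rewrite xy; exact: principal_ideal_self.
split.
  apply/(reaching_nf a bp cq pq)/(reachingP _ _ _ (esym xa)).
  by rewrite gvE; apply/reaching_nf => //; exact: reach_refl.
suff : reaching (chain_end b p) (gv a) by rewrite gvE => /reaching_nf; apply.
by apply: (reachingP _ _ _ xa); apply/reaching_nf => //; exact: reach_refl.
Qed.

End JClasses.

(** * Embeddings of graphs *)

Section Embedding.
Variables (F E : digraph) (fv : vertex F -> vertex E) (fe : edge F -> edge E).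
Hypothesis fe_src : forall e, esrc (fe e) = fv (esrc e).
Hypothesis fe_tgt : forall e, etgt (fe e) = fv (etgt e).
Hypotheses (fv_inj : injective fv) (fe_inj : injective fe).

Fixpoint term_map (t : gis_term F) : gis_term E :=
  match t with
  | TZero => TZero E
  | TVertex a => TVertex (fv a)
  | TEdge e => TEdge (fe e)
  | TInv e => TInv (fe e)
  | TMul s t => TMul (term_map s) (term_map t)
  end.

Lemma term_map_rel s t : gis_rel s t -> gis_rel (term_map s) (term_map t).
Proof.
elim=> {s t} /=.
- by move=> s; exact: gis_refl.
- by move=> s t _; apply: gis_sym.
- by move=> s t u _ st _; apply: gis_trans.
- by move=> s s' t t' _ IHs _ IHt; exact: gis_mul.
- by move=> s t u; exact: gis_mulA.
- by move=> s; exact: gis_mul0l.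
- by move=> s; exact: gis_mul0r.
- by move=> a; exact: gis_vertex_eq.
- by move=> a b ab; apply: gis_vertex_neq => /fv_inj.
- by move=> e; rewrite -fe_src; exact: gis_src_edge.
- by move=> e; rewrite -fe_tgt; exact: gis_edge_tgt.
- by move=> e; rewrite -fe_src; exact: gis_inv_src.
- by move=> e; rewrite -fe_tgt; exact: gis_tgt_inv.
- by move=> e; rewrite -fe_tgt; exact: gis_inv_eq.
- by move=> e f ef; apply: gis_inv_neq => /fe_inj.
Qed.

Definition gis_map (x : gis F) : gis E := gis_of (term_map (repr x)).

Lemma gis_map_of t : gis_map (gis_of t) = gis_of (term_map t).
Proof.
apply/gis_of_eq/term_map_rel; apply/(cquot_eqP (gis_congruence F)).
by rewrite reprK.
Qed.

Lemma gis_mapM x y : gis_map (x * y) = gis_map x * gis_map y.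
Proof.
have [[s ->] [t ->]] := (gis_of_surj x, gis_of_surj y).
by rewrite -gis_ofM !gis_map_of -gis_ofM.
Qed.

Lemma gis_map0 : gis_map zero = zero.
Proof. exact: gis_map_of. Qed.

Lemma gis_map_gp a p : gis_map (gp a p) = gp (fv a) (map fe p).
Proof.
elim: p a => [|e p IHp] a /=; first exact: gis_map_of.
by rewrite gis_mapM gis_map_of IHp fe_tgt.
Qed.

Lemma gis_map_gpi a p : gis_map (gpi a p) = gpi (fv a) (map fe p).
Proof.
elim: p a => [|e p IHp] a /=; first exact: gis_map_of.
by rewrite gis_mapM gis_map_of IHp fe_tgt.
Qed.

Definition state_map (z : state F) : state E := (fv z.1, map fe z.2).

Lemma asbool_fv a b : `[< fv a = fv b >] = `[< a = b >].
Proof. by apply: asbool_equiv_eq; split=> [/fv_inj|->]. Qed.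

Lemma gact_map x z : gact (gis_map x) (state_map z) = omap state_map (gact x z).
Proof.
have [t ->] := gis_of_surj x; rewrite gis_map_of !gact_of.
elim: t z => [|a|e|e|s IHs t IHt] z //=.
- by rewrite asbool_fv; case: asboolP.
- by rewrite fe_tgt fe_src asbool_fv; case: asboolP => //= _; rewrite -fe_src.
- case: z => a [|f p] //=; rewrite fe_src.
  have -> : `[< fv a = fv (esrc e) /\ fe e = fe f >] = `[< a = esrc e /\ e = f >].
    by apply: asbool_equiv_eq; split=> [[/fv_inj-> /fe_inj->]|[-> ->]].
  by case: asboolP => //= _; rewrite fe_tgt.
- by rewrite IHt; case: (tact t z) => //= w; rewrite IHs.
Qed.

(** The image of x acts on the images of the states of F as x does on F, and the
    action of G(F) is faithful. *)
Lemma gis_map_inj : injective gis_map.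
Proof.
have state_map_inj : injective state_map.
  by move=> [a p] [b q] [/fv_inj-> /(inj_map fe_inj)->].
move=> x y xy; apply: gact_inj => z; apply: (inj_omap state_map_inj).
by rewrite -!gact_map xy.
Qed.

End Embedding.

(** * Coordinates on the J-class of a component *)

Section Component.
Variables (E : digraph) (A : set (vertex E)).
Hypothesis compA : strongly_connected_component A.

Local Notation F := (induced_subgraph A).
Local Notation Q := (set_type (first_paths_into A)).

Definition subvertex (a : vertex F) : vertex E := sval a.
Definition subedge (e : edge F) : edge E := sval e.

Lemma subvertex_inj : injective subvertex.
Proof. by move=> [a Aa] [b Ab] /= ab; exact: eq_exist. Qed.

Lemma subedge_inj : injective subedge.
Proof. by move=> [e Ae] [f Af] /= ef; exact: eq_exist. Qed.

Definition incl : gis F -> gis E := gis_map subvertex subedge.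

Lemma inclM x y : incl (x * y) = incl x * incl y.
Proof. by apply: gis_mapM => //; [exact: subvertex_inj|exact: subedge_inj]. Qed.

Lemma incl0 : incl zero = zero.
Proof. by apply: gis_map0 => //; [exact: subvertex_inj|exact: subedge_inj]. Qed.

Lemma incl_inj : injective incl.
Proof. by apply: gis_map_inj => //; [exact: subvertex_inj|exact: subedge_inj]. Qed.

Lemma incl_gp a p : incl (gp a p) = gp (subvertex a) (map subedge p).
Proof. by apply: gis_map_gp => //; [exact: subvertex_inj|exact: subedge_inj]. Qed.

Lemma incl_gpi a p : incl (gpi a p) = gpi (subvertex a) (map subedge p).
Proof. by apply: gis_map_gpi => //; [exact: subvertex_inj|exact: subedge_inj]. Qed.

Lemma incl_gv a : incl (gv a) = gv (subvertex a).
Proof. exact: (incl_gp a [::]). Qed.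

Lemma chain_lift (a : vertex F) p :
  chain (subvertex a) p -> A (chain_end (subvertex a) p) ->
  exists2 q, chain a q & p = map subedge q.
Proof.
elim: p a => [|e p IHp] a /=; first by move=> _ Aa; exists [::].
move=> [ea ep] Ap.
have Asrc : A (esrc e) by rewrite ea; exact: (svalP a).
have Atgt : A (etgt e).
  apply: (component_convex compA Asrc Ap); first by exists [:: e].
  by exists p.
pose e' : edge F := exist _ e (conj Asrc Atgt).
have [q qc pE] := IHp (etgt e') ep Ap.
exists (e' :: q); last by rewrite pE.
by split=> //; exact: subvertex_inj.
Qed.

Definition qp (u : Q) : gis E := gp (psrc (val u)) (pedges (val u)).
Definition qpi (u : Q) : gis E := gpi (psrc (val u)) (pedges (val u)).
Definition qtgt (u : Q) : vertex F := exist _ (ptgt (val u)) (set_valP u).1.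

Lemma qpi_qp u : qpi u * qp u = incl (gv (qtgt u)).
Proof. by rewrite incl_gv; apply: gpi_gp; exact: pchain. Qed.

Lemma qpi_qp_neq u v : u <> v -> qpi u * qp v = zero.
Proof.
move=> uv; case: (gpi_gp_prefix (pchain (val u)) (pchain (val v))) => //.
move=> [uv_src uv_prefix]; case: uv; apply: val_inj.
have [uQ vQ] := (set_valP u, set_valP v).
case: uv_prefix => -[r rE]; [|apply/esym];
  by apply: first_paths_prefix; try eassumption; apply/prefix_pathP; split=> //; exists r.
Qed.

(** The condition that makes spread multiplicative: the product of the images of
    (a, s, b) and (b, t, d) contains s r(b) t, which has to be s t. *)
Definition cornered (t : brandt Q (gis F)) : Prop :=
  if t is BTriple a s b then gv (qtgt a) * s * gv (qtgt b) = s else True.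

Definition spread (t : brandt Q (gis F)) : gis E :=
  if t is BTriple a s b then qp a * incl s * qpi b else zero.

Lemma cornered_l a s b : cornered (BTriple a s b) -> gv (qtgt a) * s = s.
Proof. by move=> /= <-; rewrite !mulgA gvv. Qed.

Lemma cornered_r a s b : cornered (BTriple a s b) -> s * gv (qtgt b) = s.
Proof. by move=> /= <-; rewrite -!mulgA gvv. Qed.

Lemma corneredM x y : cornered x -> cornered y -> cornered (x * y).
Proof.
case: x y => [|a s b] [|c t d] //= abE cdE; rewrite /mul /=; case: asboolP => //= _.
by rewrite mulgA (cornered_l abE) -mulgA (cornered_r cdE).
Qed.

Lemma spreadM x y : cornered x -> cornered y -> spread (x * y) = spread x * spread y.
Proof.
case: x y => [|a s b] [|c t d] abE cdE; rewrite ?mul0s ?muls0 //.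
rewrite [_ * BTriple _ _ _]/mul /=; case: asboolP => [<-|bc] /=; last first.
  by rewrite -!mulgA (mulgA (qpi b)) qpi_qp_neq // mul0s !muls0.
rewrite inclM -!mulgA (mulgA (qpi b)) qpi_qp (mulgA (incl s) (incl (gv _))) -inclM.
by rewrite (cornered_r abE).
Qed.

(** The products a^-1 a and b^-1 b that arise are vertices absorbed by s. *)
Lemma spread_unspread a s b : cornered (BTriple a s b) ->
  qpi a * spread (BTriple a s b) * qp b = incl s.
Proof.
move=> abE /=; rewrite !mulgA qpi_qp -inclM (cornered_l abE).
by rewrite -mulgA qpi_qp -inclM (cornered_r abE).
Qed.

Lemma spread_eq0 x : cornered x -> spread x = zero -> brandt_ideal x.
Proof.
case: x => [|a s b] abE; first by left.
move=> x0; right; exists a, b; congr BTriple; apply: incl_inj.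
by rewrite -(spread_unspread abE) x0 muls0 mul0s incl0.
Qed.

Lemma brandt_ideal_spread x : brandt_ideal x -> spread x = zero.
Proof. by case=> [->//|[a [b ->]]] /=; rewrite incl0 muls0 mul0s. Qed.

Lemma spread_ker x y : cornered x -> cornered y ->
  spread x = spread y <-> rees_rel (@brandt_ideal Q (gis F)) x y.
Proof.
move=> xc yc; split=> [xy|[->//|[x0 y0]]]; last by rewrite !brandt_ideal_spread.
have [x0|x0] := pselect (spread x = zero).
  by right; split; apply: spread_eq0 => //; rewrite -xy.
left; have y0 : spread y <> zero by rewrite -xy.
case: x y xc yc xy x0 y0 => [|a s b] [|c t d] // abE cdE xy x0 _.
have t0 : incl t <> zero.
  by move=> t0; apply: x0; rewrite xy /= t0 muls0 mul0s.
(* Multiplying the common image by c^-1 on the left and by d on the right gives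
   back t; the result would be 0 if c differed from a or d from b. *)
have ca : c = a.
  apply: contrapT => ca; apply: t0; rewrite -(spread_unspread cdE) -xy /=.
  by rewrite !mulgA qpi_qp_neq // !mul0s.
have bd : b = d.
  apply: contrapT => bd; apply: t0; rewrite -(spread_unspread cdE) -xy /=.
  by rewrite -!mulgA qpi_qp_neq // !muls0.
subst c d; congr BTriple; apply: incl_inj.
by rewrite -(spread_unspread abE) xy (spread_unspread cdE).
Qed.

(** The image of a cornered triple with middle entry s = u v^-1 is J-equivalent
    to the vertex r(u); conversely, both paths of a
    normal form in J_A are cut at their first visits to A, and the remainders form
    the middle entry. *)
Lemma spread_image : spread @` cornered = component_Jclass0 A.
Proof.
rewrite seteqP; split=> [_ [x xc <-]|x].
  case: x xc => [|a s b] abE; first by right.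
  case: (normal_formP s) => [s0|c p d q cp dq pq sE].
    by right; apply: brandt_ideal_spread; right; exists a, b; rewrite s0.
  left; exists (subvertex (chain_end c p)); first exact: svalP.
  rewrite -/(gv _).
  apply: (greenJ_mul (l := incl (gpi c p) * qpi a) (r := qp b * incl (gp d q))
    (l' := qp a * incl (gp c p)) (r' := incl (gpi d q) * qpi b)).
    have <- : incl (gpi c p) * incl s * incl (gp d q) = gv (subvertex (chain_end c p)).
      rewrite -!inclM -incl_gv sE !mulgA gpi_gp // -!mulgA gpi_gp // -pq.
      by rewrite gvv.
    by rewrite -(spread_unspread abE) !mulgA.
  rewrite [LHS]/=.
  have <- : incl (gp c p) * gv (subvertex (chain_end c p)) * incl (gpi d q) = incl s.
    by rewrite -incl_gv -!inclM sE gp_gv.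
  by rewrite !mulgA.
move=> [[a Aa xa]|->]; last by exists BZero.
case: (normal_formP x) xa => [->|b p c q bp cq pq ->] xa; first by exists BZero.
have Ap : A (chain_end b p).
  have [ap pa] := greenJ_vertex_nf bp cq pq xa.
  exact: (component_convex compA Aa Aa ap pa).
have [u uQ [p' [ub pE up']]] := first_visit bp Ap.
have Aq : A (chain_end c q) by rewrite -pq.
have [v vQ [q' [vc qE vq']]] := first_visit cq Aq.
pose u' : Q := SigSub (mem_set uQ); pose v' : Q := SigSub (mem_set vQ).
have pEend : chain_end (ptgt u) p' = chain_end b p.
  by rewrite pE chain_end_cat /ptgt ub.
have qEend : chain_end (ptgt v) q' = chain_end c q.
  by rewrite qE chain_end_cat /ptgt vc.
have [|p1 p1c p1E] := @chain_lift (qtgt u') p' up'.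
  by rewrite pEend.
have [|q1 q1c q1E] := @chain_lift (qtgt v') q' vq'.
  by rewrite qEend.
exists (BTriple u' (gp (qtgt u') p1 * gpi (qtgt v') q1) v') => /=.
  by rewrite mulgA gv_gp // -mulgA gpi_gv.
rewrite inclM incl_gp incl_gpi -p1E -q1E /qp /qpi /= !mulgA.
rewrite pE qE -ub -vc gp_cat // gpi_cat //.
by rewrite !mulgA.
Qed.

Lemma Jclass0_isomorphic :
  isomorphic_subsemigroups (component_Jclass0 A)
    ((fun x => \pi_(cquot (rees_congruence (@brandt_idealP Q (gis F)))) x
        : brandt0 Q (gis F)) @` cornered).
Proof.
rewrite -spread_image.
apply: (isomorphic_images BZero) => x y xc yc.
  split; [exact: corneredM|exact: spreadM|exact/esym/cquot_mulE].
rewrite spread_ker //; apply: iff_sym; exact: cquot_eqP.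
Qed.

End Component.

Theorem theorem8 (E : digraph) (A : set (vertex E)) :
  strongly_connected_component A ->
  exists T : set (brandt0 (set_type (first_paths_into A))
                          (gis (induced_subgraph A))),
    isomorphic_subsemigroups (component_Jclass0 A) T.
Proof. by move=> compA; eexists; exact: Jclass0_isomorphic. Qed.
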